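(* Let $\mu$ be a positive measure on a measurable space $(\Omega,\mathcal B)$ whose range $\{\mu(A):A\in\mathcal B\}$ is a finite interval, and let $\nu$ be a signed measure on $(\Omega,\mathcal B)$ satisfying condition $(\mathcal L)$ with respect to $\mu$. Suppose that either $\nu$ is positive, or $\nu$ is a signed measure with $\frac{d\nu}{d\mu}\in L_\infty(\mu)$. Then $\nu=\alpha\mu$ for some constant $\alpha\in\mathbb R$.
   Context: A signed measure $\nu$ satisfies condition $(\mathcal L)$ with respect to $\mu$ if for all $A,B\in\mathcal B$ with $\mu(A)=\mu(B)\neq\pm\infty$ one has $\nu(A)=\nu(B)\neq\pm\infty$. (In particular, taking $A=\emptyset$, $\nu\ll\mu$, and $\frac{d\nu}{d\mu}$ denotes the Radon–Nikodym derivative.) *)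

(* Defs.v *)
From HB Require Import structures.
From mathcomp Require Import all_boot all_order all_algebra.
From mathcomp Require Import all_classical all_reals all_analysis.
Set Implicit Arguments. Unset Strict Implicit. Unset Printing Implicit Defensive.
Import Order.TTheory GRing.Theory Num.Theory.
Local Open Scope classical_set_scope.
Local Open Scope ring_scope.
Local Open Scope ereal_scope.

Definition range_finite_interval d (T : measurableType d) (R : realType)
  (mu : set T -> \bar R) : Prop :=
  (forall A, measurable A -> mu A \is a fin_num) /\
  (forall A B, measurable A -> measurable B ->
     forall z : \bar R, mu A <= z <= mu B ->
       exists C, measurable C /\ mu C = z).

Definition condition_L d (T : measurableType d) (R : realType)
  (mu nu : set T -> \bar R) : Prop :=
  forall A B, measurable A -> measurable B ->
    mu A = mu B -> mu A \is a fin_num ->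
    nu A = nu B /\ nu A \is a fin_num.

(* Main.v *)
(** Condition (L) says that [nu A] is a function [f] of [mu A]. Since the range
    of [mu] is an interval, the space can be exhausted by disjoint pieces [E n]
    of measure [a n], each at most as large as the total measure [t n.+1] of the
    pieces after it (Kakeya's condition). The greedy algorithm then represents
    every [x] in [[0, t n.+1]] by pieces after [E n], so that
    [f (x + a n) = f x + nu (E n)] on [[0, t n.+1]].

    When [nu] is positive, these equations make [f] monotone, and, comparing
    [f (t 0)] with the increments of [f] over about [t 0 / a n] consecutive
    intervals of length [a n], give [f (t 0) / t 0 <= 3 * nu (E n) / a n].
    Applied to [f - I * x], where [I] is the infimum of [nu (E n) / a n], this
    forces [f (t 0) = I * t 0], and by monotonicity [f x = I * x].

    When [nu] has a bounded density, [c * mu - nu] is positive for some [c]. *)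
Require Import Defs.
From HB Require Import structures.
From mathcomp Require Import all_boot all_order all_algebra.
From mathcomp Require Import all_classical all_reals all_analysis.
From mathcomp Require Import measurable_realfun ess_sup_inf lra zify.
Import Order.TTheory GRing.Theory Num.Theory.
Import numFieldNormedType.Exports.
Local Open Scope classical_set_scope.
Local Open Scope ring_scope.

(** * Functional equations on an interval under Kakeya's condition *)

(** [a n] and [b n] model the two measures of the [n]-th piece, [t n] that of the remainder it is
    taken from. The last field bounds [t n] and [f] at the same index. *)
Record kakeya_system (R : realType) (a b t : nat -> R) (f : R -> R) : Prop :=
  KakeyaSystem {
  kakeya_tail : forall n, t n = a n + t n.+1 ;
  kakeya_ge0 : forall n, 0 <= a n ;
  kakeya_le : forall n, a n <= t n.+1 ;
  kakeya_wt : forall n, 0 <= b n ;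
  kakeya_shift : forall n x, 0 <= x -> x <= t n.+1 -> f (x + a n) = f x + b n ;
  kakeya_cvg0 : forall e, 0 < e ->
    exists n, t n <= e /\ forall x, 0 <= x -> x <= t n -> `|f x| <= e }.
Arguments kakeya_system {R}.
Arguments kakeya_tail {R a b t f}.
Arguments kakeya_ge0 {R a b t f}.
Arguments kakeya_le {R a b t f}.
Arguments kakeya_wt {R a b t f}.
Arguments kakeya_shift {R a b t f}.
Arguments kakeya_cvg0 {R a b t f}.

Lemma forall_gt0_eq0 (R : realType) (x : R) :
  (forall e, 0 < e -> `|x| <= e) -> x = 0.
Proof.
move=> h; apply/normr0_eq0/eqP; rewrite eq_le normr_ge0 andbT.
by apply/ler_addgt0Pr => e e0; rewrite add0r h.
Qed.

Section real.
Context {R : realType} {a b t : nat -> R} {f : R -> R}.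
Hypothesis K : kakeya_system a b t f.

Lemma kakeya_tail_ge0 n : 0 <= t n.
Proof.
by have := kakeya_le K n; have := kakeya_tail K n;
  have := kakeya_ge0 K n; lra.
Qed.

Lemma kakeya_tail_le m n : (m <= n)%N -> t n <= t m.
Proof.
elim: n => [|n IH]; first by rewrite leqn0 => /eqP ->.
rewrite leq_eqVlt => /orP[/eqP ->//|]; rewrite ltnS => /IH.
by have := kakeya_ge0 K n; have := kakeya_tail K n; lra.
Qed.

Lemma kakeya_fun0 : f 0 = 0.
Proof.
apply: forall_gt0_eq0 => e e0; have [n [_]] := kakeya_cvg0 K e e0.
by apply => //; exact: kakeya_tail_ge0.
Qed.

Lemma kakeya_fun_term n : f (a n) = b n.
Proof.
have := kakeya_shift K n 0; rewrite add0r kakeya_fun0 add0r.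
by apply => //; exact: kakeya_tail_ge0.
Qed.

(** If [x > t n.+1], then [x - a n] lies in [[0, t n.+1]] and only the weight [b n >= 0] is lost;
    this is repeated down to a scale where [f >= - e]. *)
Lemma kakeya_fun_ge0 n x : 0 <= x -> x <= t n -> 0 <= f x.
Proof.
move=> x0 xt; apply/ler_addgt0Pl => e e0; rewrite -lerBlDl sub0r.
have [m [_ fm]] := kakeya_cvg0 K e e0.
have [mn|/ltnW nm] := leqP m n.
  have := fm x x0 (le_trans xt (kakeya_tail_le _ _ mn)).
  by rewrite ler_norml => /andP[].
rewrite -(subnKC nm) in fm; move: (m - n)%N fm => k {nm m}.
elim: k n x x0 xt => [|k IH] n x x0 xt fm.
  by rewrite addn0 in fm; have := fm x x0 xt; rewrite ler_norml => /andP[].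
have tn := kakeya_tail K n; rewrite addnS -addSn in fm.
have [xt'|xt'] := leP x (t n.+1); first exact: (IH n.+1).
have alt := kakeya_le K n.
have x'0 : 0 <= x - a n by lra.
have x't : x - a n <= t n.+1 by lra.
have := kakeya_shift K _ _ x'0 x't; rewrite subrK => ->.
by have := IH _ _ x'0 x't fm; have := kakeya_wt K n; lra.
Qed.

(* If [x < a n <= y], then [f y = b n + f (y - a n) >= b n = f (a n)] and the
   pair [x <= a n] is compared one scale further down. *)
Lemma kakeya_mono n x y : 0 <= x -> x <= y -> y <= t n -> f x <= f y.
Proof.
move=> x0 xy yt; apply/ler_addgt0Pr => e e0.
have [m [_ fm]] := kakeya_cvg0 K e e0.
(* From scale [m] on, [f u <= e] while [f v >= 0]. *)
have base k u v : (m <= k)%N -> 0 <= u -> u <= v -> v <= t k -> f u <= f v + e.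
  move=> mk u0 uv vt; have := fm u u0.
  have -> : u <= t m.
    exact: le_trans uv (le_trans vt (kakeya_tail_le _ _ mk)).
  rewrite ler_norml => /(_ isT) /andP[_].
  by have := kakeya_fun_ge0 k v (le_trans u0 uv) vt; lra.
have [mn|/ltnW nm] := leqP m n; first exact: (base n).
rewrite -(subnKC nm) in base; move: (m - n)%N base => k {nm fm m}.
elim: k n x y x0 xy yt => [|k IH] n x y x0 xy yt base.
  by apply: (base n) => //; rewrite addn0.
have tn := kakeya_tail K n; rewrite addnS -addSn in base.
have {}IH u v := fun p q r => IH n.+1 u v p q r base.
have alt := kakeya_le K n.
have sh u : a n <= u -> u <= t n -> f u = f (u - a n) + b n.
  by move=> au ut; rewrite -(kakeya_shift K) ?subrK; lra.
have [ya|ya] := ltP y (a n); first by apply: IH; lra.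
have [xa|xa] := ltP x (a n).
  rewrite (sh y)//; have := kakeya_fun_ge0 n.+1 (y - a n).
  have := IH x (a n) x0 (ltW xa) alt; rewrite kakeya_fun_term.
  move=> h1 h2; have : 0 <= f (y - a n) by apply: h2; lra.
  by lra.
rewrite (sh x) ?(sh y)//; last lra.
have : f (x - a n) <= f (y - a n) + e by apply: IH; lra.
by lra.
Qed.

(* The translates [p, p + a n] along which [f] increases by exactly [b n] have
   starting points that are [a n]-dense in [[0, t k - a n]]. *)
Lemma kakeya_translates n k x : (k <= n)%N -> 0 <= x -> x <= t k - a n ->
  exists p q, [/\ 0 <= p <= x, x <= q <= t k - a n, q <= p + a n,
    f (p + a n) = f p + b n & f (q + a n) = f q + b n].
Proof.
(* The induction also carries the last translate, starting at [t k - a n]; it bridges the gap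
   between the translates of level [k.+1] and their shifts by [a k]. *)
move=> kn; suff: f (t k - a n + a n) = f (t k - a n) + b n /\
  (0 <= x -> x <= t k - a n -> exists p q, [/\ 0 <= p <= x, x <= q <= t k - a n,
  q <= p + a n, f (p + a n) = f p + b n & f (q + a n) = f q + b n]).
  by case=> _ h; exact: h.
have an0 := kakeya_ge0 K n.
rewrite -(subKn kn); move: (n - k)%N (leq_subr k n) => j {kn k}.
elim: j x => [|j IH] x jn.
  rewrite subn0; have tn := kakeya_tail K n.
  have sh u : 0 <= u -> u <= t n - a n -> f (u + a n) = f u + b n.
    by move=> u0 ut; apply: (kakeya_shift K) => //; lra.
  split; first by apply: sh; have := kakeya_tail_ge0 n.+1; lra.
  move=> x0 xt; exists x, x; split; rewrite ?lexx ?x0 ?xt//; [lra|exact: sh|exact: sh].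
have e : (n - j = (n - j.+1).+1)%N by lia.
set k := (n - j.+1)%N in e *; rewrite {}e in IH.
have tk := kakeya_tail K k.
have ak := kakeya_ge0 K k.
have akt := kakeya_le K k.
have kn : (k.+1 <= n)%N by lia.
have tnk := kakeya_tail_le _ _ kn.
have ant : a n <= t n.
  by have := kakeya_tail K n; have := kakeya_tail_ge0 n.+1; lra.
have sh u : 0 <= u -> u <= t k.+1 - a n -> f (u + a n) = f u + b n ->
    f (u + a k + a n) = f (u + a k) + b n.
  move=> u0 ut fu; rewrite addrAC.
  have := kakeya_shift K k (u + a n).
  have := kakeya_shift K k u.
  by move=> h1 h2; rewrite h2 ?h1; lra.
have {}IH u := IH u (ltnW jn).
have [fmax _] := IH 0.
have fmax' : f (t k - a n + a n) = f (t k - a n) + b n.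
  have -> : t k - a n = t k.+1 - a n + a k by lra.
  by apply: sh; lra.
split=> // x0 xt.
have [xt'|xt'] := leP x (t k.+1 - a n).
  have [_ /(_ x0 xt') [p [q [/andP[? ?] /andP[? ?] ? ? ?]]]] := IH x.
  by exists p, q; split => //; lra.
have [xa|xa] := ltP x (a k); last first.
  have [_ []] := IH (x - a k); [lra|lra|].
  move=> p [q [/andP[? ?] /andP[? ?] ? ? ?]].
  by exists (p + a k), (q + a k); split; rewrite ?sh//; lra.
(* In the gap, [p] starts the last translate of level [k.+1] and [q] the first shifted one;
   [q <= p + a n] amounts to [a k <= t k.+1]. *)
exists (t k.+1 - a n), (a k); split => //; try lra.
by rewrite -[a k]add0r; apply: sh => //; [lra|rewrite add0r kakeya_fun_term kakeya_fun0 add0r].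
Qed.

(** For neighbouring starting points [p <= x <= q], monotonicity gives [f (x + a n) <= f q + b n <=
    f (p + a n) + b n = f p + 2 * b n]. *)
Lemma kakeya_step n x : 0 <= x -> x + a n <= t 0 ->
  f (x + a n) <= f x + b n + b n.
Proof.
move=> x0 xt.
have [p [q [/andP[p0 px] /andP[xq qt] qp fp fq]]] :
  exists p q, [/\ 0 <= p <= x, x <= q <= t 0 - a n, q <= p + a n,
    f (p + a n) = f p + b n & f (q + a n) = f q + b n].
  by apply: kakeya_translates => //; lra.
have h1 : f (x + a n) <= f (q + a n) by apply: (kakeya_mono 0); lra.
have h2 : f q <= f (p + a n) by apply: (kakeya_mono 0); lra.
have h3 : f p <= f x by apply: (kakeya_mono 0); lra.
lra.
Qed.

(** Walking down from [t 0] in steps of [a n] costs at most [2 * b n] per step and [b n] for the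
    last partial one; as [a n <= t 0], this gives the factor 3. *)
Lemma kakeya_density n : f (t 0) * a n <= (t 0 *+ 3) * b n.
Proof.
have [an0|an0] := eqVneq (a n) 0.
  by rewrite an0 -kakeya_fun_term an0 kakeya_fun0 !mulr0.
have {an0}an0 : 0 < a n by rewrite lt_neqAle eq_sym an0 (kakeya_ge0 K).
have bn0 := kakeya_wt K n.
have ant0 : a n <= t 0.
  have := kakeya_tail K n; have := kakeya_tail_ge0 n.+1.
  by have := kakeya_tail_le _ _ (leq0n n); lra.
suff key N x : 0 <= x -> x <= t 0 -> x <= a n * N%:R ->
    f x * a n <= b n * (x *+ 2 + a n).
  have [N NP] : exists N, t 0 <= a n * N%:R.
    exists (Num.bound (t 0 / a n)); rewrite mulrC -ler_pdivrMr//.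
    by apply/ltW/archi_boundP/divr_ge0; [exact: kakeya_tail_ge0|exact: ltW].
  apply: (le_trans (key N _ (kakeya_tail_ge0 0) (lexx _) NP)).
  by rewrite mulrC ler_wpM2r// mulr2n; lra.
elim: N x => [|N IH] x x0 xt xN.
  have -> : x = 0 by rewrite mulr0 in xN; lra.
  by rewrite kakeya_fun0 mul0r mul0rn add0r mulr_ge0// ltW.
have [xa|xa] := leP x (a n).
  have : f x <= f (a n) by apply: (kakeya_mono 0).
  by rewrite kakeya_fun_term => h; rewrite mulr2n; nra.
have := kakeya_step n (x - a n); rewrite subrK => /(_ _ xt) h.
have {}h : f x <= f (x - a n) + b n + b n by apply: h; lra.
have h2 : f (x - a n) * a n <= b n * ((x - a n) *+ 2 + a n).
  apply: IH; [lra|lra|]; by move: xN; rewrite -natr1 mulrDr mulr1; lra.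
have : f x * a n <= (f (x - a n) + b n + b n) * a n by rewrite ler_wpM2r// ltW.
by rewrite mulr2n in h2 *; lra.
Qed.

End real.

Lemma kakeya_linear (R : realType) (a b t : nat -> R) (f : R -> R) :
  kakeya_system a b t f ->
  exists alpha, forall x, 0 <= x -> x <= t 0 -> f x = alpha * x.
Proof.
move=> K; have at0 := kakeya_ge0 K.
have [t00|t0] := eqVneq (t 0) 0.
  exists 0 => x x0; rewrite t00 => x0'.
  by have -> : x = 0; [lra|rewrite mulr0 (kakeya_fun0 K)].
have {}t0 : 0 < t 0 by rewrite lt_neqAle eq_sym t0 (kakeya_tail_ge0 K).
(* The supremum of [S] is the infimum of [b n / a n] over [a n > 0], phrased without division. *)
pose S := [set c : R | 0 <= c /\ forall n, c * a n <= b n].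
have S0 : S 0 by split => // n; rewrite mul0r (kakeya_wt K).
have Sub : has_ubound S.
  (* Were all [a n] zero, [t] would be constant and positive. *)
  have [n an] : exists n, 0 < a n.
    apply: contrapT => /forallNP an.
    have a0 n : a n = 0.
      by apply/eqP; rewrite eq_le at0 andbT leNgt; apply/negP/an.
    have tn n : t n = t 0.
      by elim: n => // n <-; rewrite (kakeya_tail K n) a0 add0r.
    have [] := kakeya_cvg0 K (t 0 / 2); first lra.
    by move=> n []; rewrite tn; lra.
  by exists (b n / a n) => c [_ /(_ n)]; rewrite ler_pdivlMr.
pose I := sup S.
have Iub c : S c -> c <= I by move=> Sc; apply: ub_le_sup.
have SI : S I.
  split; first exact: Iub.
  move=> n; have [an0|an0] := eqVneq (a n) 0.
    by rewrite an0 mulr0 (kakeya_wt K).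
  rewrite -ler_pdivlMr; last by rewrite lt_neqAle eq_sym an0 at0.
  apply: ge_sup; first by exists 0.
  move=> c [_ /(_ n)]; rewrite ler_pdivlMr//.
  by rewrite lt_neqAle eq_sym an0 at0.
have [I0 Ile] := SI.
have K' : kakeya_system a (fun n => b n - I * a n) t (fun x => f x - I * x).
  split; [exact: (kakeya_tail K)|exact: at0
    |exact: (kakeya_le K)| | |].
  - by move=> n; rewrite subr_ge0.
  - by move=> n x x0 xt; rewrite (kakeya_shift K)//; lra.
  (* This choice bounds both [f x] and [I * x] by [e] on [[0, t n]]. *)
  move=> e e0; have [|n [tn fn]] := kakeya_cvg0 K (e / (I + 1)).
    by rewrite divr_gt0//; lra.
  have I1 : 0 < I + 1 by lra.
  rewrite ler_pdivlMr// in tn.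
  exists n; split => [|x x0 xt]; first by have := kakeya_tail_ge0 K n; nra.
  have := fn _ x0 xt; rewrite ler_pdivlMr// => fx.
  have : 0 <= f x by apply: (kakeya_fun_ge0 K n).
  rewrite ler_norml => fx0; rewrite ger0_norm// in fx.
  by apply/andP; split; nra.
(* By [kakeya_density], a positive excess divided by [3 * t 0] could be added to [I] within [S]. *)
have f0 : f (t 0) - I * t 0 = 0.
  apply/eqP; rewrite eq_le (kakeya_fun_ge0 K' 0 _ (kakeya_tail_ge0 K 0))// andbT.
  have := Iub (I + (f (t 0) - I * t 0) / (t 0 *+ 3)).
  rewrite gerDl pmulr_lle0 ?invr_gt0 ?pmulrn_lgt0//; apply; split.
    rewrite addr_ge0// divr_ge0// ?mulrn_wge0 ?(ltW t0)//.
    exact: (kakeya_fun_ge0 K' 0 _ (kakeya_tail_ge0 K 0)).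
  move=> n; have := kakeya_density K' n.
  rewrite -ler_pdivrMl ?pmulrn_lgt0// => h.
  by rewrite mulrDl mulrAC [_ / _]mulrC; lra.
exists I => x x0 xt; apply/eqP; rewrite -subr_eq0 eq_le.
rewrite (kakeya_fun_ge0 K' 0 _ x0 xt) andbT -f0.
exact: (kakeya_mono K' 0).
Qed.

(** * Finite measures with real values: exhaustion and atoms *)

(** Countable additivity enters as continuity from above; by monotonicity one index within [e] is
    enough. *)
Record real_measure {d} {T : measurableType d} {R : realType}
    (m : set T -> R) : Prop := RealMeasure {
  real_measure_ge0 : forall A, measurable A -> 0 <= m A ;
  real_measureU : forall A B, measurable A -> measurable B ->
    A `&` B = set0 -> m (A `|` B) = m A + m B ;
  real_measure_cont : forall F : (set T)^nat, (forall n, measurable (F n)) ->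
    (forall n, F n.+1 `<=` F n) -> forall e, 0 < e ->
    exists n, m (F n) < m (\bigcap_n F n) + e }.
Arguments real_measure_ge0 {d T R m}.
Arguments real_measureU {d T R m}.
Arguments real_measure_cont {d T R m}.

Definition atom {d} {T : measurableType d} {R : realType} (m : set T -> R)
  (A : set T) := [/\ measurable A, 0 < m A &
    forall B, measurable B -> B `<=` A -> m B = 0 \/ m B = m A].

Section measure.
Context {d : measure_display} {T : measurableType d} {R : realType}.
Context {m : set T -> R}.
Hypothesis H : real_measure m.

Lemma real_measure0 : m set0 = 0.
Proof.
have := real_measureU H set0 set0 measurable0 measurable0 (setI0 _).
by rewrite setU0; lra.
Qed.

Lemma real_measureD A B : measurable A -> measurable B -> B `<=` A ->
  m (A `\` B) = m A - m B.
Proof.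
move=> mA mB BA; have mD := measurableD mA mB.
have := real_measureU H _ _ mB mD (setDIK B A).
by rewrite setDUK// => ->; lra.
Qed.

Lemma real_measureDI A B : measurable A -> measurable B ->
  m A = m (A `&` B) + m (A `\` B).
Proof.
move=> mA mB; rewrite -(real_measureU H).
- by rewrite setUIDK.
- exact: measurableI.
- exact: measurableD.
- by rewrite -subset0 => y [[_ By] [_ /(_ By)]].
Qed.

Lemma real_measure_le A B : measurable A -> measurable B -> A `<=` B ->
  m A <= m B.
Proof.
move=> mA mB AB; have := real_measureD _ _ mB mA AB.
by have := real_measure_ge0 H _ (measurableD mB mA); lra.
Qed.

(* Each selected set has at least half the supremal measure of the candidates,
   and the measures of the selected sets are summable. *)
Lemma exhaustion (Inv : set T -> Prop) (Cand : set T -> set T -> Prop) :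
  Inv set0 -> (forall U, Inv U -> measurable U /\ Cand U set0) ->
  (forall U E, Inv U -> Cand U E ->
     [/\ measurable E, U `&` E = set0 & Inv (U `|` E)]) ->
  exists U : (set T)^nat, [/\ U 0%N = set0, forall n, Inv (U n),
    forall n, exists2 E, Cand (U n) E & U n.+1 = U n `|` E &
    forall e, 0 < e -> exists n, forall E, Cand (U n) E -> m E < e].
Proof.
move=> inv0 invC invU.
have half U : Inv U -> exists E, Cand U E /\
    forall F, Cand U F -> m F <= m E + m E.
  move=> iU; pose S := [set m E | E in Cand U].
  have S0 : S !=set0 by exists (m set0), set0 => //; exact: (invC _ iU).2.
  have Sub : has_ubound S.
    exists (m setT) => _ [E CE <-]; have [mE _ _] := invU _ _ iU CE.
    exact: real_measure_le.
  have [s0|s0] := leP (sup S) 0.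
    exists set0; split => [|F CF]; first exact: (invC _ iU).2.
    rewrite real_measure0 addr0; apply: le_trans s0.
    by apply: ub_le_sup => //; exists F.
  have [_ [E CE <-]] := sup_adherent (divr_gt0 s0 (ltr0Sn R 1)) (conj S0 Sub).
  move=> hE; exists E; split => // F CF.
  have : m F <= sup S by apply: ub_le_sup => //; exists F.
  by lra.
have /choice [E EP] : forall U, exists E, Inv U -> Cand U E /\
    forall F, Cand U F -> m F <= m E + m E.
  move=> U; have [iU|niU] := pselect (Inv U).
    by have [E ?] := half U iU; exists E.
  by exists set0 => /niU.
pose U n := iter n (fun V => V `|` E V) set0.
have iU n : Inv (U n).
  by elim: n => //= n IH; have [_ _] := invU _ _ IH (EP _ IH).1.
exists U; split => // [n|e e0].
  by exists (E (U n)) => //; exact: (EP _ (iU n)).1.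
apply: contrapT => /forallNP h.
have step n : e / 2 <= m (E (U n)).
  rewrite leNgt; apply/negP => lt; apply: (h n) => F CF.
  by have := (EP _ (iU n)).2 _ CF; lra.
have big n : e / 2 * n%:R <= m (U n).
  elim: n => [|n IH]; first by rewrite mulr0 real_measure0.
  have [mE UE _] := invU _ _ (iU n) (EP _ (iU n)).1.
  rewrite /U iterS -/(U n) real_measureU//; last exact: (invC _ (iU n)).1.
  by rewrite -[n.+1%:R]natr1 mulrDr mulr1; have := step n; lra.
have M0 := real_measure_ge0 H _ (@measurableT _ T).
have e2 : 0 < e / 2 by lra.
have := archi_boundP (divr_ge0 M0 (ltW e2)).
rewrite ltr_pdivrMr// mulrC => lt.
have := big (Num.bound (m setT / (e / 2))).
have := real_measure_le _ _ (invC _ (iU (Num.bound (m setT / (e / 2))))).1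
  (@measurableT _ T) (@subsetT _ _).
by move: lt; set x := e / 2 * _; lra.
Qed.

(** A set of positive measure that is not an atom splits into two parts of positive measure, one of
    them at most half as large; this is iterated. *)
Lemma atomless_small N e : measurable N -> 0 < m N -> 0 < e ->
  (forall A, A `<=` N -> ~ atom m A) ->
  exists F, [/\ measurable F, F `<=` N, 0 < m F & m F < e].
Proof.
move=> mN N0 e0 atN.
have key n : exists F, [/\ measurable F, F `<=` N, 0 < m F &
    m F * n.+1%:R <= m N].
  elim: n => [|n [F [mF FN F0 Fn]]]; first by exists N; split; rewrite ?mulr1.
  have [B [mB BF B0 BlF]] : exists B, [/\ measurable B, B `<=` F, 0 < m B &
      m B < m F].
    apply: contrapT => nB; apply: (atN F FN); split => // B mB BF.
    apply: contrapT => /not_orP [B0 BlF]; apply: nB; exists B; split => //.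
      rewrite lt_neqAle (real_measure_ge0 H)// andbT eq_sym.
      exact/eqP.
    by rewrite lt_neqAle (real_measure_le _ _ mB mF)// andbT; exact/eqP.
  have mD := measurableD mF mB.
  have DE := real_measureD _ _ mF mB BF.
  have half x : 0 < x -> x <= m F / 2 -> x * n.+2%:R <= m N.
    move=> x0 xF; apply: le_trans Fn.
    have : n.+2%:R <= 2 * n.+1%:R :> R by rewrite -natrM ler_nat; lia.
    have : 0 < n.+1%:R :> R by rewrite ltr0n.
    by move=> ? ?; nra.
  have [Bh|Bh] := leP (m B) (m F / 2).
    by exists B; split => //; [exact: subset_trans FN|exact: half].
  exists (F `\` B); split => //; [|lra|by apply: half; lra].
  by apply: subset_trans FN; exact: subDsetl.
have [F [mF FN F0 Fn]] := key (Num.bound (m N / e)).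
exists F; split => //.
have := archi_boundP (divr_ge0 (ltW N0) (ltW e0)).
rewrite ltr_pdivrMr// => lt.
have n0 : 0 <= (Num.bound (m N / e))%:R :> R by [].
rewrite ltNge; apply/negP => eF.
rewrite -natr1 in Fn.
by nra.
Qed.

(** Sets are added while the total stays at most [x]. If the limit fell short, a small subset of the
    rest of [N] would be a candidate at every stage, although candidates become arbitrarily
    small. *)
Lemma sierpinski N x : measurable N -> 0 <= x -> x <= m N ->
  (forall A, A `<=` N -> ~ atom m A) ->
  exists C, [/\ measurable C, C `<=` N & m C = x].
Proof.
move=> mN x0 xN atN.
pose Inv U := [/\ measurable U, U `<=` N & m U <= x].
pose Cand U E := [/\ measurable E, E `<=` N `\` U & m U + m E <= x].
have [||U E [mU UN Ux] [mE EN Ex]|U [U0 iU UE small]] := exhaustion Inv Cand.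
- by split => //; rewrite real_measure0.
- move=> U [mU UN Ux]; split => //; split => //.
  by rewrite real_measure0 addr0.
- have UE0 : U `&` E = set0.
    by rewrite -subset0 => y [Uy /EN[]].
  split => //; split; first exact: measurableU.
    by rewrite subUset; split => // y /EN[].
  by rewrite real_measureU.
have mU n : measurable (U n) by have [] := iU n.
have UN n : U n `<=` N by have [] := iU n.
pose F n := N `\` U n.
have mF n : measurable (F n) by exact: measurableD.
have FE : \bigcap_n F n = N `\` \bigcup_n U n.
  rewrite eqEsubset; split => y /=.
    move=> h; split; first by have [] := h 0%N I.
    by move=> [n _ Uy]; have [] := h n I.
  by move=> [Ny nU] n _; split => // Uy; apply: nU; exists n.
have mV : measurable (\bigcup_n U n) by exact: bigcup_measurable.
have VN : \bigcup_n U n `<=` N by apply: bigcup_sub => n _.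
(* Continuity from above is applied to the decreasing sets [F n]. *)
have Vx : m (\bigcup_n U n) <= x.
  apply/ler_addgt0Pl => e e0.
  have [n|n] := real_measure_cont H F mF _ e e0.
    by rewrite /F; have [E _ ->] := UE n; apply: setDS; exact: subsetUl.
  rewrite FE !real_measureD//; have [_ _] := iU n; lra.
exists (\bigcup_n U n); split => //.
apply/eqP; rewrite eq_le Vx leNgt; apply/negP => Vlt.
have DE := real_measureD _ _ mN mV VN.
have [||||G [mG GN G0 Gx]] :=
  atomless_small (N `\` \bigcup_n U n) (x - m (\bigcup_n U n)).
- exact: measurableD.
- lra.
- lra.
- by move=> A AN; apply: atN; apply: subset_trans AN _; exact: subDsetl.
have [n smalln] := small _ G0; suff /smalln : Cand (U n) G by rewrite ltxx.
split => //; first by apply: subset_trans GN _; apply: setDS; exact: bigcup_sup.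
have := real_measure_le _ _ (mU n) mV (bigcup_sup (I : [set: nat] n)).
by lra.
Qed.

(** Otherwise ever larger atoms, overlapping in null sets and each of measure at least [m A0], would
    exceed the total measure. *)
Lemma max_atom V : (exists2 A, A `<=` V & atom m A) ->
  exists E, [/\ E `<=` V, atom m E &
    forall A, A `<=` V -> atom m A -> m A <= m E].
Proof.
move=> [A0 A0V atA0]; apply: contrapT => /forallNP nE.
have bigger E : E `<=` V -> atom m E ->
    exists B, [/\ B `<=` V, atom m B & m E < m B].
  move=> EV atE; apply: contrapT => nB; apply: (nE E); split => // A AV atA.
  by rewrite leNgt; apply/negP => lt; apply: nB; exists A.
have null A B : measurable B -> atom m A -> m B < m A -> m (A `&` B) = 0.
  move=> mB [mA _ atA] BA.
  have [//|E] := atA _ (measurableI _ _ mA mB) (@subIsetl _ _ _).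
  have := real_measure_le _ _ (measurableI _ _ mA mB) mB (@subIsetr _ _ _).
  by lra.
(* [U] is the union of [n] atoms smaller than [F]. *)
have key n : exists U F, [/\ measurable U, F `<=` V /\ atom m F, m A0 <= m F,
    m A0 * n%:R <= m U &
    forall B, atom m B -> m F <= m B -> m (B `&` U) = 0].
  elim: n => [|n [U [F [mU [FV atF] AF Un Unull]]]].
    exists set0, A0; split => //; first by rewrite mulr0 real_measure0.
    by move=> B _ _; rewrite setI0 real_measure0.
  have [B [BV atB FB]] := bigger F FV atF; have [mF _ _] := atF.
  have mUF := measurableU _ _ mU mF.
  exists (U `|` F), B; split => //; first lra.
    have -> : U `|` F = U `|` (F `\` U).
      apply/seteqP; split => y [Uy|]; [by left| |by left|by case=> Fy; right].
      by have [Uy|nUy] := pselect (U y); [left|right].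
    rewrite (real_measureU H) ?setDIK//; last exact: measurableD.
    have := real_measureDI _ _ mF mU; rewrite Unull// add0r => <-.
    by rewrite -natr1 mulrDr mulr1; lra.
  move=> C atC BC; have [mC _ _] := atC.
  have := real_measureDI _ _ (measurableI _ _ mC mUF) mU.
  have -> : C `&` (U `|` F) `&` U = C `&` U.
    by rewrite -setIA setUK.
  rewrite Unull//; last lra.
  rewrite add0r => ->; apply/eqP; rewrite eq_le; apply/andP; split.
    rewrite -(null C F) //; last lra.
    apply: real_measure_le.
    - by apply: measurableD => //; exact: measurableI.
    - exact: measurableI.
    - by move=> y [[Cy [//|Fy]] nU].
  by apply: (real_measure_ge0 H); apply: measurableD => //; exact: measurableI.
have [mA0 a0 _] := atA0.
have [U [F [mU _ _ Un _]]] := key (Num.bound (m setT / m A0)).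
have M0 := real_measure_ge0 H _ (@measurableT _ T).
have := archi_boundP (divr_ge0 M0 (ltW a0)).
rewrite ltr_pdivrMr// mulrC.
have := real_measure_le _ _ mU (@measurableT _ T) (@subsetT _ _).
by move: Un; set x := m A0 * _; lra.
Qed.

End measure.

(** * Exhaustion by pieces satisfying Kakeya's condition *)

Section decomposition.
Context {d : measure_display} {T : measurableType d} {R : realType}.
Context {m : set T -> R}.
Hypothesis H : real_measure m.

(** The part of the interval property that survives the removal of suitable pieces: measures of
    subsets of [V] approach the measure of each atom in [V] strictly from below. *)
Definition ample (V : set T) := forall A, A `<=` V -> atom m A ->
  forall y, y < m A -> exists C, [/\ measurable C, C `<=` V, y < m C & m C < m A].

(* The set remaining at the limit cannot contain an atom (a largest atom of each
   remaining set is a candidate), and an atomless remainder of positive measure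
   could be halved. *)
Lemma kakeya_sets : ample setT -> exists V : (set T)^nat, [/\ V 0%N = setT,
  forall n, measurable (V n), forall n, V n.+1 `<=` V n,
  forall n, m (V n `\` V n.+1) <= m (V n.+1) &
  forall e, 0 < e -> exists n, m (V n) < e].
Proof.
move=> amT.
(* [U] collects the removed pieces; a new piece must leave an ample remainder at least as large as
   itself. *)
pose Inv U := measurable U /\ ample (~` U).
pose Cand U E := [/\ measurable E, E `<=` ~` U, ample (~` U `\` E) &
  m E <= m (~` U `\` E)].
have [||U E [mU aU] [mE EU aUE lUE]|U [U0 iU UE small]] := exhaustion H Inv Cand.
- by split => //; rewrite setC0.
- move=> U [mU aU]; split => //; split => //; rewrite ?setD0//.
  by rewrite (real_measure0 H) (real_measure_ge0 H)//; exact: measurableC.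
- split => //; first by rewrite -subset0 => y [Uy /EU].
  by split; [exact: measurableU|rewrite setCU -setDE].
pose V n := ~` U n.
have mV n : measurable (V n) by apply: measurableC; have [] := iU n.
have aV n : ample (V n) by have [] := iU n.
have VE n : exists2 E, Cand (U n) E & V n.+1 = V n `\` E.
  by rewrite /V; have [E CE ->] := UE n; exists E => //; rewrite setCU setDE.
have Vle n : V n.+1 `<=` V n by have [E _ ->] := VE n; exact: subDsetl.
exists V; split => //; first by rewrite /V U0 setC0.
  move=> n; have [E [_ EV _ le] ->] := VE n.
  by rewrite setDD setIC (setIidl EV).
set W := \bigcap_n V n.
have mW : measurable W by exact: bigcapT_measurable.
have WV n : W `<=` V n by move=> y; apply.
suff W0 : m W = 0.
  by move=> e e0; have [n] := real_measure_cont H V mV Vle e e0;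
     rewrite -/W W0 add0r; exists n.
apply: contrapT => /eqP mWn0.
have {mWn0}mW0 : 0 < m W by rewrite lt_neqAle eq_sym mWn0 (real_measure_ge0 H).
(* A subset of [V n] smaller than the atom [E] meets [E] in a null set, so it can be moved off [E].
   Hence ampleness survives the removal of [E], and [E] cannot exceed what remains. *)
have maxC n E : E `<=` V n -> atom m E ->
    (forall A, A `<=` V n -> atom m A -> m A <= m E) -> Cand (U n) E.
  move=> EV atE maxE; have [mE E0 _] := atE.
  have avoid C : measurable C -> C `<=` V n -> m C < m E ->
      C `\` E `<=` V n `\` E /\ m (C `\` E) = m C.
    move=> mC CV CE; split; first exact: setSD.
    have [_ _ /(_ _ (measurableI _ _ mC mE) (@subIsetr _ _ _))] := atE.
    have := real_measureDI H _ _ mC mE.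
    have := real_measure_le H _ _ (measurableI _ _ mC mE) mC (@subIsetl _ _ _).
    by move=> ? ? [|]; lra.
  split => //.
    move=> A AV atA y yA.
    have AVn : A `<=` V n by apply: subset_trans AV _; exact: subDsetl.
    have [C [mC CV yC CA]] := aV n A AVn atA y yA.
    have [CD CE] := avoid C mC CV (lt_le_trans CA (maxE A AVn atA)).
    by exists (C `\` E); rewrite CE; split => //; exact: measurableD.
  rewrite leNgt; apply/negP => lt.
  have [C [mC CV yC CA]] := aV n E EV atE _ lt.
  have [CD CE] := avoid C mC CV CA.
  have := real_measure_le H _ _ (measurableD mC mE) (measurableD (mV n) mE) CD.
  by rewrite CE /V; lra.
have max_small n A : A `<=` V n -> atom m A -> exists2 E, Cand (U n) E & m A <= m E.
  move=> AV atA; have [|E [EV atE maxE]] := max_atom H (V n); first by exists A.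
  by exists E; [exact: maxC|exact: maxE].
have atW A : A `<=` W -> ~ atom m A.
  move=> AW atA; have [_ A0 _] := atA; have [n smalln] := small _ A0.
  have [E /smalln] := max_small n A (subset_trans AW (WV n)) atA.
  by lra.
have W2 : 0 < m W / 2 by lra.
have [||F [mF FW Fh]] := sierpinski H _ (m W / 2) mW _ _ atW; [lra|lra|].
have mN := measurableD mW mF.
have Nh : m (W `\` F) = m W / 2 by rewrite (real_measureD H)//; lra.
(* At this stage all candidates, hence all atoms in [V n], have measure below [m W / 2]; yet [F]
   turns out to be a candidate. *)
have [n smalln] := small _ W2.
suff /smalln : Cand (U n) F by lra.
have NV : W `\` F `<=` V n `\` F by exact: setSD.
split => //; first exact: subset_trans FW (WV n).
  (* The atom [A] is smaller than the atomless set [W] minus [F], whose subsets attain every value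
     up to [m W / 2]. *)
  move=> A AV atA y yA; have [mA A0 _] := atA.
  have [E /smalln EW AE] := max_small n A (subset_trans AV (@subDsetl _ _ _)) atA.
  have [z yz zA] : exists2 z, y < z & 0 <= z < m A.
    have [y0|y0] := leP y 0; first by exists (m A / 2); lra.
    by exists ((y + m A) / 2); lra.
  have [||A' A'N|C [mC CN Cz]] := sierpinski H _ z mN; [lra|lra| |].
    by apply: atW; apply: subset_trans A'N _; exact: subDsetl.
  by exists C; rewrite Cz; split => //; [exact: subset_trans NV|lra].
have := real_measure_le H _ _ mN (measurableD (mV n) mF) NV.
by rewrite /V; lra.
Qed.

(** The part [s k] of [x] still to be represented stays at most [m (V (n + k))]: either [m (E k)] is
    subtracted from both, or [s k < m (E k) <= m (V (n + k).+1)]. *)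
Lemma greedy_subset (V : (set T)^nat) n x : (forall n, measurable (V n)) ->
  (forall n, V n.+1 `<=` V n) -> (forall n, m (V n `\` V n.+1) <= m (V n.+1)) ->
  (forall e, 0 < e -> exists n, m (V n) < e) -> 0 <= x -> x <= m (V n) ->
  exists C, [/\ measurable C, C `<=` V n & m C = x].
Proof.
move=> mV Vle aV V0 x0 xV.
pose E k := V (n + k)%N `\` V (n + k).+1.
have mE k : measurable (E k) by exact: measurableD.
have EV k : m (E k) = m (V (n + k)%N) - m (V (n + k).+1).
  by rewrite (real_measureD H).
pose s := fix s k := if k is k'.+1 then
  if m (E k') <= s k' then s k' - m (E k') else s k' else x.
have sP k : 0 <= s k <= m (V (n + k)%N).
  elim: k => [|k IH]; first by rewrite addn0 /= x0.
  rewrite /= addnS; have := EV k; have := aV (n + k)%N; rewrite -/(E k).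
  by case: ifPn; rewrite -?ltNge; lra.
have VleS i j : (i <= j)%N -> V j `<=` V i.
  elim: j => [|j IH]; first by rewrite leqn0 => /eqP ->.
  rewrite leq_eqVlt => /orP[/eqP -> //|]; rewrite ltnS => /IH.
  exact: subset_trans.
pose C := \bigcup_(k in [set k | m (E k) <= s k]) E k.
have mC : measurable C by exact: bigcup_measurable.
have CV : C `<=` V n.
  by apply: bigcup_sub => k _ y [Vy _]; exact: (VleS n (n + k)%N (leq_addr _ _)).
have mCD k : measurable (C `\` V (n + k)%N) by exact: measurableD.
have CE k : m (C `\` V (n + k)%N) = x - s k.
  elim: k => [|k IH].
    by rewrite addn0 (_ : C `\` _ = set0) ?(real_measure0 H) ?subrr// setD_eq0.
  have CS : C `\` V (n + k).+1 = (C `\` V (n + k)%N) `|` (C `&` E k).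
    apply/seteqP; split => y.
      move=> [Cy nVy]; have [Vy|nV] := pselect (V (n + k)%N y); first by right.
      by left.
    by move=> [[Cy nVy]|[Cy [_ nVy]]]; split => // /Vle.
  rewrite addnS CS (real_measureU H)//; last 2 first.
  - exact: measurableI.
  - by rewrite -subset0 => y [[_ nVy] [_ [Vy _]]].
  rewrite IH /=; case: ifPn => [le|nle].
    by rewrite (setIidr (bigcup_sup _))//; lra.
  rewrite (_ : C `&` E k = set0) ?(real_measure0 H) ?addr0//.
  rewrite -subset0 => y [[j /= jP [Vj nVj]] [Vk nVk]].
  have [jk|kj|jk] := ltngtP j k; last by rewrite jk (negbTE nle) in jP.
    by apply: nVj; apply: VleS Vk; rewrite -addnS leq_add2l.
  by apply: nVk; apply: VleS Vj; rewrite -addnS leq_add2l.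
exists C; split => //; apply/eqP; rewrite -subr_eq0; apply/eqP.
apply: forall_gt0_eq0 => e e0.
have [k Vk] := V0 e e0.
have Vnk : m (V (n + k)%N) <= m (V k).
  by apply: (real_measure_le H) => //; apply: VleS; exact: leq_addl.
(* [m C - x] is the measure of the part of [C] in [V (n + k)] minus [s k], and both lie between 0
   and [m (V (n + k))]. *)
have := real_measureDI H _ _ mC (mV (n + k)%N); rewrite CE.
have mI := measurableI _ _ mC (mV (n + k)%N).
have := real_measure_le H _ _ mI (mV (n + k)%N) (@subIsetr _ _ _).
have := real_measure_ge0 H _ mI; have := sP k.
by rewrite ler_norml; lra.
Qed.

End decomposition.

(** * Linear dependence of one real measure on another *)

Section linear.
Context {d : measure_display} {T : measurableType d} {R : realType}.
Context {m n : set T -> R}.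
Hypotheses (Hm : real_measure m) (Hn : real_measure n).

Lemma real_measure_linear :
  (forall x, 0 <= x -> x <= m setT -> exists2 C, measurable C & m C = x) ->
  (forall A B, measurable A -> measurable B -> m A = m B -> n A = n B) ->
  exists alpha, forall A, measurable A -> n A = alpha * m A.
Proof.
move=> rng mn.
have [|V [VT mV Vle aV V0]] := kakeya_sets Hm.
  move=> A _ [mA A0 _] y yA; have mAT := real_measure_le Hm _ _ mA measurableT (@subsetT _ _).
  have [z yz zA] : exists2 z, y < z & 0 <= z < m A.
    have [y0|y0] := leP y 0; first by exists (m A / 2); lra.
    by exists ((y + m A) / 2); lra.
  by have [||C mC Cz] := rng z; [lra|lra|exists C; rewrite Cz; split => //; lra].
(* [g x] is the [n]-measure of a chosen set of [m]-measure [x], with [set0] as default; [mn] makes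
   it independent of the choice. *)
pose g x := n (xget set0 [set C | measurable C /\ m C = x]).
have gE A : measurable A -> g (m A) = n A.
  move=> mA; rewrite /g; case: xgetP => [C _ [mC CA]|/(_ A)]; last by case.
  exact: mn.
have mE k : measurable (V k `\` V k.+1) by exact: measurableD.
have rep k x : 0 <= x -> x <= m (V k) -> exists C, [/\ measurable C, C `<=` V k & m C = x].
  exact: (greedy_subset Hm).
have mW : measurable (\bigcap_k V k) by exact: bigcapT_measurable.
have W0 : m (\bigcap_k V k) = 0.
  apply: forall_gt0_eq0 => e e0; have [k Vk] := V0 e e0.
  rewrite ger0_norm ?(real_measure_ge0 Hm)//.
  by apply: le_trans (ltW Vk); apply: (real_measure_le Hm) => //; exact: bigcap_inf.
(* With this, continuity from above makes [n (V k)] small, hence [g] small near 0. *)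
have nW0 : n (\bigcap_k V k) = 0.
  by rewrite -(real_measure0 Hn); apply: mn => //; rewrite W0 (real_measure0 Hm).
have VleS i j : (i <= j)%N -> V j `<=` V i.
  elim: j => [|j IH]; first by rewrite leqn0 => /eqP ->.
  rewrite leq_eqVlt => /orP[/eqP -> //|]; rewrite ltnS => /IH.
  exact: subset_trans.
have [|alpha alphaP] := @kakeya_linear R (fun k => m (V k `\` V k.+1))
    (fun k => n (V k `\` V k.+1)) (fun k => m (V k)) g.
  split.
  - by move=> k; rewrite (real_measureD Hm)//; lra.
  - by move=> k; exact: (real_measure_ge0 Hm).
  - exact: aV.
  - by move=> k; exact: (real_measure_ge0 Hn).
  (* A representation of [x] inside [V k.+1] is disjoint from the [k]-th piece, so both measures add
     up. *)
  - move=> k x x0 xV; have [C [mC CV <-]] := rep _ _ x0 xV.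
    have CE : C `&` (V k `\` V k.+1) = set0 by rewrite -subset0 => y [/CV ? []].
    rewrite -(real_measureU Hm)// !gE//; last exact: measurableU.
    by rewrite (real_measureU Hn).
  - move=> e e0; have [i Vi] := V0 e e0.
    have [j] := real_measure_cont Hn V mV Vle e e0.
    rewrite nW0 add0r => Vj; exists (maxn i j); split => [|x x0].
      apply: le_trans (ltW Vi); apply: (real_measure_le Hm) => //.
      by apply: VleS; exact: leq_maxl.
    move=> /(rep _ _ x0)[C [mC CV <-]]; rewrite gE//.
    rewrite ger0_norm ?(real_measure_ge0 Hn)//.
    apply: le_trans (ltW Vj); apply: (real_measure_le Hn) => //.
    by apply: subset_trans CV _; apply: VleS; exact: leq_maxr.
exists alpha => A mA; rewrite -gE// alphaP//; first exact: (real_measure_ge0 Hm).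
by rewrite VT; apply: (real_measure_le Hm).
Qed.

End linear.

(** * Positive charges and charges with bounded density *)

Local Open Scope ereal_scope.

Lemma charge_real_measure (d : measure_display) (T : measurableType d)
    (R : realType) (nu : {charge set T -> \bar R}) :
  (forall A, measurable A -> 0 <= nu A) -> real_measure (fine \o nu).
Proof.
move=> nu0; split => [A mA|A B mA mB AB|F mF Fle e e0] /=.
- exact/fine_ge0/nu0.
- by rewrite chargeU// fineD// fin_num_measure.
(* [nu] need not be nonnegative on nonmeasurable sets, so it is not a measure
   itself. *)
have pos A : 0 <= crestr0 nu measurableT A.
  by rewrite /crestr0; case: ifPn => // /set_mem mA; rewrite /crestr setIT nu0.
pose M : {measure set T -> \bar R} := measure_of_charge _ pos.
have posE A : measurable A -> M A = nu A.
  by move=> mA; rewrite /M /= /measure_of_charge /crestr0 mem_set// /crestr setIT.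
have mW : measurable (\bigcap_n F n) by exact: bigcapT_measurable.
have := @nonincreasing_cvg_mu _ _ _ M F.
rewrite (posE _ mW) posE// => cv.
have {}cv : nu \o F @ \oo --> nu (\bigcap_n F n).
  have -> : nu \o F = M \o F.
    by apply/funext => n /=; rewrite posE.
  apply: cv => //; first by rewrite ltey_eq fin_num_measure.
  by apply/nonincreasing_seqP => n; exact/subsetPset/Fle.
have {}cv : (fine \o nu) (F n) @[n --> \oo] --> fine (nu (\bigcap_n F n)).
  by apply: fine_cvg; rewrite fineK ?fin_num_measure.
have /cvgrPdist_lt /(_ e e0) [n _ /(_ n (leqnn n))] := cv.
by rewrite /= ltr_norml => h; exists n; lra.
Qed.

Lemma Radon_Nikodym_bounded (d : measure_display) (T : measurableType d)
    (R : realType) (mu : {finite_measure set T -> \bar R})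
    (nu : {charge set T -> \bar R}) :
  nu `<< mu -> Lnorm mu +oo (Radon_Nikodym nu mu) < +oo ->
  exists c : R, forall A, measurable A -> nu A <= c%:E * mu A.
Proof.
move=> numu; rewrite unlock.
have intf := Radon_Nikodym_integrable numu.
(* The norm at infinity is the essential supremum if [mu setT > 0] and 0 otherwise; in the latter
   case [mu], hence [nu], vanishes on measurable sets. *)
case: ifPn => [mu0 bd|mu0 _]; last first.
  exists 0%R => A mA; rewrite mul0e.
  have muA : mu A = 0.
    apply/eqP; rewrite eq_le measure_ge0 andbT.
    have : mu A <= mu setT by apply: le_measure; rewrite ?inE.
    by move/le_trans; apply; rewrite leNgt.
  by rewrite ((null_content_dominatesP _ _).1 numu A mA muA).
set s := ess_sup _ _ in bd.
have s0 : 0 <= s by apply: ess_sup_gee => //; apply: filterE => x; exact: abse_ge0.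
exists (fine s) => A mA; rewrite (Radon_Nikodym_integral numu mA).
rewrite fineK ?ge0_fin_numE// -(integral_cst mu mA).
apply: le_trans (lee_abs _) _.
have mf := measurable_funTS (D := A) (measurable_int mu intf).
apply: le_trans (le_abse_integral mu mA mf) _.
apply: ae_ge0_le_integral => //.
- exact: measurableT_comp.
- have := @ess_sup_ge _ _ _ mu (abse \o Radon_Nikodym nu mu).
  by apply: filterS => x + _.
Qed.

Lemma positive_condition_L_linear (d : measure_display) (T : measurableType d)
    (R : realType) (mu : {finite_measure set T -> \bar R})
    (nu : {charge set T -> \bar R}) :
  range_finite_interval mu -> condition_L mu nu ->
  (forall A, measurable A -> 0 <= nu A) ->
  exists alpha : R, forall A, measurable A -> nu A = alpha%:E * mu A.
Proof.
move=> [mufin rng] L nu0.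
have Hmu : real_measure (fine \o mu).
  exact: (charge_real_measure _ _ _ (charge_of_finite_measure mu)).
have [||alpha alphaP] := real_measure_linear Hmu (charge_real_measure _ _ _ nu nu0).
- move=> x x0 xM; have [|C [mC Cx]] := rng _ _ measurable0 measurableT x%:E.
    by rewrite measure0 lee_fin x0 -[leRHS]fineK ?mufin//.
  by exists C => //=; rewrite Cx.
- move=> A B mA mB AB; congr fine; apply: (L A B mA mB _ (mufin A mA)).1.
  by rewrite -[LHS]fineK ?mufin// -[RHS]fineK ?mufin//; congr EFin.
exists alpha => A mA.
by rewrite -[nu A]fineK ?fin_num_measure// -[mu A]fineK ?mufin// -EFinM -alphaP.
Qed.

Theorem theorem2p4 (d : measure_display) (T : measurableType d) (R : realType)
  (mu : {finite_measure set T -> \bar R}) (nu : {charge set T -> \bar R}) :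
  range_finite_interval mu ->
  condition_L mu nu ->
  ((forall A, measurable A -> 0 <= nu A) \/
   Lnorm mu +oo (Radon_Nikodym nu mu) < +oo) ->
  exists alpha : R, forall A, measurable A -> nu A = alpha%:E * mu A.
Proof.
move=> rng L [nu0|bd]; first exact: positive_condition_L_linear _ _ _ _ _ rng L nu0.
have mufin := rng.1.
have numu : nu `<< mu.
  apply/null_content_dominatesP => A mA A0.
  have [] := L A set0 mA measurable0; rewrite ?A0 ?measure0//.
  by rewrite charge0.
have [c nuc] := Radon_Nikodym_bounded _ _ _ _ _ numu bd.
(* [rho] is positive by the choice of [c] and inherits condition (L); the positive case then gives
   the factor [c - alpha] for [nu]. *)
pose rho : {charge set T -> \bar R} :=
  cadd (cscale c (charge_of_finite_measure mu)) (copp nu).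
have rhoE A : rho A = c%:E * mu A - nu A by [].
have [A B mA mB AB Afin|A mA|alpha alphaP] :=
    positive_condition_L_linear _ _ _ mu rho rng.
- by rewrite !rhoE AB (L A B mA mB AB Afin).1 -rhoE fin_num_measure.
- by rewrite rhoE sube_ge0 ?fin_num_measure// nuc.
exists (c - alpha)%R => A mA; have := alphaP A mA.
rewrite rhoE -[nu A]fineK ?fin_num_measure// -[mu A]fineK ?mufin//.
by rewrite -!EFinM -EFinB => -[h]; congr EFin; lra.
Qed.
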